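(* Every positive integer can be expressed as a sum of distinct, non-consecutive Fibonacci numbers. Further, for every $n\ge 1$ and every integer $k\ge 0$, the probability that an integer $N$ chosen uniformly at random from $[F_n,F_{n+1})$ has exactly $k+1$ summands in its Zeckendorf decomposition is $$p_n(k)=\frac{\binom{n-1-k}{k}}{F_{n-1}}.$$
   Context: The Fibonacci numbers are indexed by $F_1=1$, $F_2=2$, and $F_n=F_{n-1}+F_{n-2}$ for $n\ge 3$ (so $F_3=3$, $F_4=5$), with $F_0=1$ by extending the recurrence backwards; the interval $[F_n,F_{n+1})$ contains exactly $F_{n+1}-F_n=F_{n-1}$ integers. The Zeckendorf decomposition of $N$ is its representation $N=F_{m_1}+\cdots+F_{m_r}$ with indices $m_j\ge 1$ and $m_{j+1}\ge m_j+2$ for all $j$ (such a representation is unique); its number of summands is $r$. The binomial coefficient $\binom{n-1-k}{k}$ is taken to be $0$ when $k>\lfloor (n-1)/2\rfloor$. *)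

(* Defs.v *)
From mathcomp Require Import all_boot all_order all_algebra.
From mathcomp Require Import boolp classical_sets.

Set Implicit Arguments.
Unset Strict Implicit.
Unset Printing Implicit Defensive.

(* Shifted indexing: fib 0 = 1, fib 1 = 1, fib 2 = 2, fib 3 = 3, fib 4 = 5. *)
Fixpoint fib (n : nat) : nat :=
  match n with
  | 0 => 1
  | 1 => 1
  | (m.+1 as p).+1 => fib p + fib m
  end.

Arguments fib : simpl never.

(* [m] lists the indices in increasing order.  Indices start at 1, since 1 is
   both fib 0 and fib 1. *)
Definition is_zeckendorf (N : nat) (m : seq nat) : bool :=
  [&& all (leq 1) m, sorted (fun i j => i + 2 <= j) m
    & N == \sum_(i <- m) fib i].

Lemma fib_SS n : fib n.+2 = fib n.+1 + fib n.
Proof. by []. Qed.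

Lemma fib_gt0 n : 0 < fib n.
Proof. by elim/ltn_ind: n => -[|[|n]] IH //; rewrite fib_SS addn_gt0 IH. Qed.

Lemma fib_mono : {homo fib : i j / i <= j}.
Proof.
apply: homo_leq => // [i j k|]; first exact: leq_trans.
by case=> // n; rewrite fib_SS leq_addr.
Qed.

Lemma sorted_gap_rcons s x :
  sorted (fun i j => i + 2 <= j) (rcons s x) ->
  sorted (fun i j => i + 2 <= j) s.
Proof. by case: s => //= y s; rewrite rcons_path => /andP[]. Qed.

Lemma zeckendorf_sum_lt s x :
  all (leq 1) (rcons s x) -> sorted (fun i j => i + 2 <= j) (rcons s x) ->
  \sum_(i <- rcons s x) fib i < fib x.+1.
Proof.
elim/last_ind: s x => [|s y IH] x.
  by case: x => // x _ _; rewrite big_seq1 fib_SS -addn1 leq_add2l fib_gt0.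
rewrite all_rcons => /andP[x1 a] so.
have yx : y + 2 <= x.
  by move: so; case: (s) => [|z s'] /=; rewrite ?andbT // rcons_path last_rcons => /andP[].
rewrite big_rcons /=.
have lt := IH y a (sorted_gap_rcons so).
case: x x1 yx {so} => // x _ yx.
rewrite fib_SS addnC ltn_add2l.
by apply: (leq_trans lt); apply: fib_mono; rewrite addn2 in yx.
Qed.

Lemma zeckendorf_unique N s t :
  is_zeckendorf N s -> is_zeckendorf N t -> s = t.
Proof.
elim/last_ind: s N t => [|s x IH] N t.
  case/and3P=> _ _ /eqP ->; rewrite big_nil => /and3P[_ _].
  by case: t => // y t; rewrite big_cons eq_sym addn_eq0 eqn0Ngt fib_gt0.
move=> /and3P[a1 s1 /eqP eN]; elim/last_ind: t => [|t y _].
  case/and3P=> _ _; rewrite eN big_nil big_rcons //= addn_eq0.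
  by rewrite [fib x == 0]eqn0Ngt fib_gt0 ?andbF.
case/and3P=> a2 s2 /eqP eN'.
have b1 := zeckendorf_sum_lt a1 s1; have b2 := zeckendorf_sum_lt a2 s2.
rewrite -eN in b1; rewrite -eN' in b2.
have c1 : fib x <= N by rewrite eN big_rcons //= ?leq_addl ?leq_addr.
have c2 : fib y <= N by rewrite eN' big_rcons //= ?leq_addl ?leq_addr.
have exy : x = y.
  case: (ltngtP x y) => // lt.
    by have := leq_trans b1 (leq_trans (fib_mono lt) c2); rewrite ltnn.
  by have := leq_trans b2 (leq_trans (fib_mono lt) c1); rewrite ltnn.
rewrite -{}exy in a2 s2 eN' *; congr rcons.
move: a1 a2; rewrite !all_rcons => /andP[_ a1] /andP[_ a2].
apply: (IH (N - fib x)); apply/and3P; split=> //.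
- exact: sorted_gap_rcons s1.
- by rewrite eN big_rcons //= ?addnK ?addKn.
- exact: sorted_gap_rcons s2.
- by rewrite eN' big_rcons //= ?addnK ?addKn.
Qed.

(* [::] serves as default if N has no Zeckendorf decomposition; by uniqueness
   (zeckendorfE) no actual choice is involved. *)
Definition zeckendorf (N : nat) : seq nat :=
  xget [::] [set m | is_zeckendorf N m]%classic.

Lemma zeckendorfE N m : is_zeckendorf N m -> zeckendorf N = m.
Proof.
move=> Nm; apply: (@zeckendorf_unique N) => //.
exact: (@xgetPex _ [::] [set m | is_zeckendorf N m]%classic (ex_intro _ m Nm)).
Qed.

Definition num_summands (N : nat) : nat := size (zeckendorf N).

(* The probability of the event E for an integer drawn uniformly at random from
   the half-open interval [a, b), which is assumed to be nonempty. *)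
Definition uniform_prob (a b : nat) (E : pred nat) : rat :=
  ((count E (index_iota a b))%:R / (size (index_iota a b))%:R)%R.

(* Truncated subtraction in 'C(n - 1 - k, k) respects the convention that the
   coefficient vanishes for k > (n - 1) / 2. *)
Lemma bin_trunc_eq0 n k : (n - 1)./2 < k -> 'C(n - 1 - k, k) = 0.
Proof.
move=> h; apply: bin_small; move: h; rewrite ltn_half_double -addnn => h.
have k0 : 0 < k by case: k h.
by rewrite ltn_psubLR.
Qed.

(* Main.v *)
Require Import Defs.
From mathcomp Require Import all_boot all_order all_algebra.

Set Implicit Arguments.
Unset Strict Implicit.

(* Adding fib n.+1 to a number below fib n appends the index n.+1 to its
   decomposition.  Hence the numbers of [fib n.+1, fib n.+2) with k.+1 summands
   are in bijection with the numbers below fib n with k summands, and the count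
   of the latter satisfies Pascal's recurrence for 'C(n - k, k). *)

Lemma is_zeckendorf_rcons n N m :
  N < fib n -> is_zeckendorf N m -> is_zeckendorf (fib n.+1 + N) (rcons m n.+1).
Proof.
move=> Nn /and3P[m1 ms /eqP mN]; apply/and3P; split.
- by rewrite all_rcons m1.
(* A summand [fib i] is at most [N < fib n], so monotonicity of [fib] forces [i < n]; the gap to
   [n.+1] is then at least 2. *)
- have lt_n i : i \in m -> i < n.
    move=> im; rewrite ltnNge; apply/negP => /fib_mono ni.
    have iN : fib i <= N by rewrite mN (big_rem i) ?leq_addr.
    by have := leq_trans Nn (leq_trans ni iN); rewrite ltnn.
  case: m ms lt_n {m1 mN} => //= x m ms lt_n.
  by rewrite rcons_path ms addn2 !ltnS lt_n ?mem_last.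
- by rewrite big_rcons /= -mN addnC.
Qed.

(** Greedy choice: if [fib n.+1 <= N < fib n.+2], the remainder [N - fib n.+1] is below [fib n], so
    induction on the bound applies. *)
Lemma zeckendorf_exists_lt n N : N < fib n -> exists m, is_zeckendorf N m.
Proof.
have z0 : is_zeckendorf 0 [::] by rewrite /is_zeckendorf big_nil.
elim/ltn_ind: n N => -[|[|n]] IH N.
- by case: N => // _; exists [::].
- by case: N => // _; exists [::].
case: (ltnP N (fib n.+1)) => [lt _|ge]; first exact: (IH n.+1).
rewrite fib_SS -(subnKC ge) ltn_add2l => lt.
have [|m zm] := IH n _ _ lt; first exact: leqnSn.
by exists (rcons m n.+1); apply: is_zeckendorf_rcons.
Qed.

Lemma leq_fib n : n <= fib n.
Proof.
elim: n => // -[//|n] IH.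
by rewrite fib_SS -addn1 leq_add ?fib_gt0.
Qed.

Lemma zeckendorf_exists N : exists m, is_zeckendorf N m.
Proof. exact: (@zeckendorf_exists_lt N.+1) (leq_fib _). Qed.

Lemma num_summands_fibD n N :
  N < fib n -> num_summands (fib n.+1 + N) = (num_summands N).+1.
Proof.
move=> Nn; have [m zm] := zeckendorf_exists N.
rewrite /num_summands (zeckendorfE zm).
by rewrite (zeckendorfE (is_zeckendorf_rcons Nn zm)) size_rcons.
Qed.

Lemma num_summands0 : num_summands 0 = 0.
Proof. by rewrite /num_summands (@zeckendorfE 0 [::]) // /is_zeckendorf big_nil. Qed.

Lemma count_fib_block (P : pred nat) n :
  count (fun N => P (num_summands N)) (index_iota (fib n.+1) (fib n.+2)) =
  count (fun N => P (num_summands N).+1) (iota 0 (fib n)).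
Proof.
rewrite /index_iota fib_SS addKn -[X in iota X _]addn0 iotaDl count_map.
apply: eq_in_count => N; rewrite mem_iota => /andP[_ Nn] /=.
by rewrite num_summands_fibD.
Qed.

Lemma count_num_summands n k :
  count (fun N => num_summands N == k) (iota 0 (fib n)) = 'C(n - k, k).
Proof.
elim/ltn_ind: n k => -[|[|n]] IH k.
- by rewrite /= num_summands0; case: k.
- by rewrite /= num_summands0; case: k => [|[|k]].
have := count_fib_block (pred1 k) n.
rewrite /index_iota {1}fib_SS addKn => block.
(* Split the range at [fib n.+1]; the upper part is a block. *)
rewrite {1}fib_SS iotaD count_cat IH // block.
case: k {block} => [|k] /=.
  (* Only 0 has no summands, so the block contributes nothing. *)
  by rewrite !bin0 (@eq_count _ _ pred0) ?count_pred0.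
rewrite (IH n) // !subSS.
(* Pascal's rule needs [k <= n]; otherwise truncated subtraction makes every upper index 0 while the
   lower ones are positive, and all three binomials vanish. *)
case: (leqP k n) => kn; first by rewrite subSn // binS.
have k0 := leq_trans (ltn0Sn n) kn.
by rewrite !bin_small ?ltn_psubLR ?ltn_addl ?ltnS ?(ltnW kn).
Qed.

Theorem theorem2p3 :
  (forall N : nat, (0 < N)%N -> exists m : seq nat, is_zeckendorf N m) /\
  (forall n k : nat, (1 <= n)%N ->
     uniform_prob (fib n) (fib n.+1) (fun N => num_summands N == k.+1) =
     ('C(n - 1 - k, k)%:R / (fib (n - 1))%:R :> rat)%R).
Proof.
split=> [N _|[//|n] k _]; first exact: zeckendorf_exists.
(* Here [n] stands for the original [n - 1], so the interval is a block of length [fib n]. *)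
rewrite subSS subn0 /uniform_prob (count_fib_block (pred1 k.+1)).
by rewrite count_num_summands size_iota fib_SS addKn.
Qed.
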